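(* Let $\mathbf\Theta^{(\log)}$ be the efficiency loss of the logarithmic investor due to liquidity shocks, i.e. the number satisfying $V^0(x)=\hat V\bigl((1-\mathbf\Theta^{(\log)})x\bigr)$ for all $x>0$, where $V^0$ is the liquid-regime value function and $\hat V$ the classical Merton value function, as given in the context. Then $$\mathbf\Theta^{(\log)}=1-\exp\left(\frac{-\theta^2}{2\rho}+\zeta(\pi^* )\,\frac{\rho+\lambda_{10}}{\rho+\lambda_{01}+\lambda_{10}}\right),\qquad\theta=\frac{\mu-r}\sigma.$$
   Context: Parameters: $\lambda_{01},\lambda_{10}>0$, $\rho>0$, $r,\mu\in\mathbb R$, $\sigma>0$, $L\in[0,1)$; $g(\pi)=\frac{\pi(1-L)}{1-\pi L}$. The classical infinite-horizon Merton problem of maximizing $\mathbb E\int_0^\infty e^{-\rho t}\log c_t\,dt$ has value function $\hat V(x)=\frac1\rho\log x+\hat h$, $\hat h=\frac{r/\rho-1+\log\rho}{\rho}+\frac{\theta^2}{2\rho^2}$. In the market with liquidity shocks (arriving at rate $\lambda_{01}$, ending at rate $\lambda_{10}$, entailing an instantaneous stock drop by the fraction $L$, with no trading and stock growth rate $r$ during shocks), the log-investor's liquid-regime value function is $V^0(x)=\frac1\rho\log x+b$ with $$b=\frac{r/\rho-1+\log\rho}{\rho}+\zeta(\pi^* )\,\frac{\rho+\lambda_{10}}{\rho(\rho+\lambda_{01}+\lambda_{10})},$$ where $\pi^*$ is the maximizer over $\pi\in[0,1]$ of $$\zeta(\pi)=\frac{(\mu-r)\pi-\pi^2\sigma^2/2}{\rho}+\frac{\lambda_{01}}{\rho+\lambda_{10}}\log\bigl(1-g(\pi)^{1+\lambda_{10}/\rho}\bigr)+\frac{\lambda_{01}}\rho\log(1-\pi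 L).$$ *)

(* Defs.v *)
(* MathComp with MathComp-Analysis. *)
From mathcomp Require Import all_boot all_order all_algebra.
From mathcomp Require Import all_classical all_reals all_analysis.
Set Implicit Arguments.
Unset Strict Implicit.
Unset Printing Implicit Defensive.
Import Order.TTheory GRing.Theory Num.Theory.
Local Open Scope ring_scope.

Section LiquidityShocks.
Variable R : realType.
(* lam01, lam10: arrival and ending rates of a shock; rho: discount rate;
   r: interest rate; mu, sigma: stock drift and volatility;
   L: fraction of the stock price lost at the start of a shock. *)
Variables lam01 lam10 rho r mu sigma L : R.

Definition g (p : R) : R := p * (1 - L) / (1 - p * L).

Definition theta : R := (mu - r) / sigma.

Definition hhat : R :=
  (r / rho - 1 + ln rho) / rho + theta ^+ 2 / (2 * rho ^+ 2).

Definition Vhat (x : R) : R := rho^-1 * ln x + hhat.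

(* Since g 1 = 1, the first logarithm is log 0 at p = 1: it is read as
   -oo, hence zeta 1 = -oo. The junk value ln 0 = 0 would allow p = 1 to be a
   spurious maximizer. The argument of the second logarithm is positive on
   [0, 1]. *)
Definition zeta (p : R) : \bar R :=
  ((((mu - r) * p - p ^+ 2 * sigma ^+ 2 / 2) / rho)%:E
   + (lam01 / (rho + lam10))%:E * lne (1 - g p `^ (1 + lam10 / rho))%:E
   + (lam01 / rho * ln (1 - p * L))%:E)%E.

Definition is_maximizer (p : R) : Prop :=
  p \in `[0, 1] /\ forall q : R, q \in `[0, 1] -> (zeta q <= zeta p)%E.

(* zeta is finite at any maximizer, because zeta 0 = 0. *)
Definition b (p : R) : R :=
  (r / rho - 1 + ln rho) / rho
  + fine (zeta p) * ((rho + lam10) / (rho * (rho + lam01 + lam10))).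

Definition V0 (p x : R) : R := rho^-1 * ln x + b p.

(* Theta < 1 says that Vhat is evaluated at positive wealth only. *)
Definition is_efficiency_loss (p Theta : R) : Prop :=
  Theta < 1 /\ forall x : R, 0 < x -> V0 p x = Vhat ((1 - Theta) * x).

End LiquidityShocks.

(* Main.v *)
Require Import Defs.
From mathcomp Require Import all_boot all_order all_algebra.
From mathcomp Require Import all_classical all_reals all_analysis.
From mathcomp Require Import ring.
Import Order.TTheory GRing.Theory Num.Theory.
Local Open Scope ring_scope.

(** Both value functions are [rho^-1 * ln x] plus a constant, so scaling wealth by [1 - Theta] only
    shifts [Vhat] by [rho^-1 * ln (1 - Theta)]. The defining identity thus reduces to one equation
    free of [x], [ln (1 - Theta) = E], with [E] equal to [rho] times the gap between the constants
    [b] and [hhat]; exponentiating solves it. *)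

Theorem mainTheorem6 (R : realType) (lam01 lam10 rho r mu sigma L : R)
  (hlam01 : 0 < lam01) (hlam10 : 0 < lam10) (hrho : 0 < rho)
  (hsigma : 0 < sigma) (hL0 : 0 <= L) (hL1 : L < 1)
  (pistar : R)
  (hpistar : is_maximizer lam01 lam10 rho r mu sigma L pistar)
  (Theta : R) :
  is_efficiency_loss lam01 lam10 rho r mu sigma L pistar Theta <->
  Theta = 1 - expR (- theta r mu sigma ^+ 2 / (2 * rho)
                    + fine (zeta lam01 lam10 rho r mu sigma L pistar)
                      * ((rho + lam10) / (rho + lam01 + lam10))).
Proof.
set E := (X in expR X).
have rho0 : rho != 0 by rewrite gt_eqF.
have lam0 : rho + lam01 + lam10 != 0 by rewrite gt_eqF // !addr_gt0.
(* Positivity of [x] and [1 - T] splits the logarithm of the product; [ln x] then cancels, as do the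
   terms shared by [b] and [hhat]. *)
have Vdiff x T : 0 < x -> T < 1 ->
    V0 lam01 lam10 rho r mu sigma L pistar x
    - Vhat rho r mu sigma ((1 - T) * x) = rho^-1 * (E - ln (1 - T)).
  move=> x0 T1; rewrite /V0 /Vhat /b /hhat lnM ?posrE ?subr_gt0 // /E.
  by field; rewrite rho0 lam0.
(* The right-hand side of [Vdiff] does not depend on [x], so the single wealth level 1 already
   determines [Theta]. *)
split=> [[T1 /(_ 1 ltr01) V01]|->].
  have /eqP := Vdiff 1 Theta ltr01 T1.
  rewrite V01 subrr eq_sym mulf_eq0 invr_eq0 (negPf rho0) subr_eq0 => /eqP ->.
  by rewrite lnK ?posrE ?subr_gt0 // subKr.
have T1 : 1 - expR E < 1 by rewrite gtrBl expR_gt0.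
split=> // x x0; apply/eqP; rewrite -subr_eq0 Vdiff //.
by rewrite subKr expRK subrr mulr0.
Qed.
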